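(* Let $m\ge 2$ be an integer, $0<p<1$, $q=1-p$ and $r=q/p$. The vertices of an $(m+1)$-gon are labeled $0,1,2,\ldots,m$ in clockwise order (with vertex $m+1$ identified with vertex $0$). A particle starts at $0$ and at each step moves to a neighboring vertex, going clockwise with probability $p$ or counterclockwise with probability $q$, the directions of successive movements being independent. Let $L_i$ denote the event that the last vertex to be visited is vertex $i$. Then for $i=1,2,\ldots,m$, $$P\{L_i\}=\begin{cases}\dfrac{1}{m} & \text{if } r=1,\\[2mm] \dfrac{r^{m-i}(r-1)}{r^m-1} & \text{if } r\neq 1.\end{cases}$$
   Context: The particle's position after $n$ steps is $Y_n=(X_1+\cdots+X_n) \bmod (m+1)$, where $X_1,X_2,\dots$ are i.i.d. with $P(X_k=1)=p$ and $P(X_k=-1)=q$. Vertex $0$ counts as visited at time $0$. The ''last vertex to be visited'' is the vertex whose first visit occurs latest, i.e. $L_i$ is the event that all vertices other than $i$ are visited before the first visit to $i$. *)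

(* Defs.v *)
From HB Require Import structures.
From mathcomp Require Import all_boot all_order all_algebra.
From mathcomp Require Import all_classical all_reals all_analysis.

Set Implicit Arguments.
Unset Strict Implicit.
Unset Printing Implicit Defensive.

Import Order.TTheory GRing.Theory Num.Theory.

Local Open Scope classical_set_scope.
Local Open Scope ring_scope.

(* int carries the discrete sigma-algebra, as nat and bool already do, so that
   {RV P >-> int} makes sense. *)
HB.instance Definition _ := isPointed.Build int 0.
HB.instance Definition _ := @isMeasurable.Build default_measure_display
  int (@discrete_measurable int) (@discrete_measurable0 int)
  (@discrete_measurableC int) (@discrete_measurableU int).

Definition mutually_independent d d' (T : measurableType d)
    (T' : measurableType d') (R : realType) (P : probability T R)
    (X : nat -> {RV P >-> T'}) : Prop :=
  forall (J : seq nat) (A : nat -> set T'), uniq J ->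
    (forall j, j \in J -> measurable (A j)) ->
    P (\bigcap_(j in [set` J]) (X j @^-1` A j)) =
    (\prod_(j <- J) P (X j @^-1` A j))%E.

Section CircularWalk.
Context d (T : measurableType d) (R : realType) (P : probability T R).
(* The polygon has m + 1 vertices; X k is the step made between times k and
   k + 1. *)
Variables (m : nat) (X : nat -> {RV P >-> int}).

(* intdiv's remainder by a positive modulus is the representative in [0, m],
   for negative sums too. *)
Definition position (n : nat) (w : T) : int :=
  ((\sum_(k < n) X k w) %% (m.+1)%:Z)%Z.

Definition first_visit (i n : nat) : set T :=
  [set w | position n w = i%:Z /\
           forall k, (k < n)%N -> position k w <> i%:Z].

Definition last_visited (i : nat) : set T :=
  [set w | exists n, first_visit i n w /\
     forall j, (j <= m)%N -> j <> i ->
       exists2 k, (k < n)%N & position k w = j%:Z].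

End CircularWalk.

(* Main.v *)
Require Import Defs.
From HB Require Import structures.
From mathcomp Require Import all_boot all_order all_algebra.
From mathcomp Require Import all_classical all_reals all_analysis.
From mathcomp Require Import zify ring lra.

Import Order.TTheory GRing.Theory Num.Theory.
Import numFieldNormedType.Exports.

Local Open Scope classical_set_scope.
Local Open Scope ring_scope.

(** Lift the walk from the polygon to the integers: let S be the partial sums
    of the steps, and put u = i - (m + 1) and v = i, the two integers next to 0
    that project to vertex i.  Vertex i is first visited when S leaves
    the open interval between u and v, and by then S has run through an interval
    of integers.  So i is the last vertex visited exactly when both of its
    neighbours, v - 1 and u + 1 in the lift, precede it.  It fails to be last in
    one of two ways: S reaches u before v - 1, or S reaches v before u + 1.
    These are mutually exclusive, because reaching u goes through u + 1 and
    reaching v goes through v - 1.  Since S almost surely leaves the interval,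
    the probability that i comes last is one minus the sum of two gambler's ruin
    probabilities (prob_last_visited).

    Gambler's ruin (prob_reach) is the statement that the walk reaches b before
    c with probability (psi c - psi 0) / (psi c - psi b), for any psi satisfying
    psi z = p psi (z + 1) + q psi (z - 1).  Freeze the walk on hitting b or c;
    the mean of the indicator of b along the frozen walk converges to the
    harmonic function with the same values at b and c, since their difference
    vanishes at both ends and its mean decays geometrically
    (stopped_mean_decay).  The passage from the i.i.d. steps to these means is
    by induction on cylinder events (prob_cylinder_stopped_walk).

    Taking psi z = r ^ z, or psi z = z if r = 1, gives the formula.  *)

(** * Covering order of a nearest-neighbour path *)

Definition reached_before (S : nat -> int) (b c : int) : Prop :=
  exists n, S n = b /\ forall k, (k < n)%N -> S k <> c.

(** The pathwise content of [last_visited], in a shape convertible to it when S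
    is the path of partial sums. *)
Definition covered_last (m : nat) (S : nat -> int) (i : nat) : Prop :=
  exists n, ((S n %% m.+1%:Z)%Z = i%:Z /\
      forall k, (k < n)%N -> (S k %% m.+1%:Z)%Z <> i%:Z) /\
    forall j, (j <= m)%N -> j <> i ->
      exists2 k, (k < n)%N & (S k %% m.+1%:Z)%Z = j%:Z.

Lemma modz_short (x d j : int) : - d <= x < d -> 0 <= j < d ->
  (x %% d)%Z = j <-> x = j \/ x = j - d.
Proof.
move=> hx hj; have [h0|h0] := leP 0 x; first by rewrite modz_small; lia.
by rewrite -(modzDr x d) modz_small; lia.
Qed.

Section SimplePath.
Context (S : nat -> int).
Hypothesis S_step : forall n, S n.+1 = S n + 1 \/ S n.+1 = S n - 1.

Lemma path_crosses_up k n y : (k <= n)%N -> S k <= y < S n ->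
  exists2 l, (k <= l < n)%N & S l = y.
Proof.
elim: n => [|n IHn] hk hy.
  by have e : k = 0%N by [lia|]; move: hy; rewrite e; lia.
have [e|hkn] := eqVneq k n.+1; first by move: hy; rewrite e; lia.
have [hyn|hyn] := ltP y (S n).
  have [||l hl <-] := IHn; [lia|lia|exists l => //; lia].
by exists n; [lia|have := S_step n; lia].
Qed.

Lemma path_crosses_down k n y : (k <= n)%N -> S n < y <= S k ->
  exists2 l, (k <= l < n)%N & S l = y.
Proof.
elim: n => [|n IHn] hk hy.
  by have e : k = 0%N by [lia|]; move: hy; rewrite e; lia.
have [e|hkn] := eqVneq k n.+1; first by move: hy; rewrite e; lia.
have [hyn|hyn] := ltP (S n) y.
  have [||l hl <-] := IHn; [lia|lia|exists l => //; lia].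
by exists n; [lia|have := S_step n; lia].
Qed.

Context (m i : nat).
Hypotheses (S0 : S 0%N = 0) (hi : (1 <= i <= m)%N).
Let u : int := i%:Z - m.+1%:Z.
Let v : int := i%:Z.

(** A path with unit steps cannot leave an interval without hitting an end. *)
Lemma path_inside n : (forall k, (k < n)%N -> S k <> u /\ S k <> v) ->
  forall k, (k < n)%N -> u < S k < v.
Proof.
move=> h k hk.
have [hv|hv] := leP v (S k).
  have [e|hn] := eqVneq (S k) v; first by have := h k hk; lia.
  have [//||l hl e] := @path_crosses_up 0 k v; first by rewrite S0; lia.
  by have := h l; lia.
have [hu|hu] := leP (S k) u; last by [].
have [e|hn] := eqVneq (S k) u; first by have := h k hk; lia.
have [//||l hl e] := @path_crosses_down 0 k u; first by rewrite S0; lia.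
by have := h l; lia.
Qed.

(** The path starts in the closed interval from u + 1 to v - 1, so it meets
    u + 1 on the way to u and v - 1 on the way to v; whichever of u and v comes
    first rules out the event about the other one. *)
Lemma reached_before_neighbours_disjoint :
  reached_before S u (v - 1) -> reached_before S v (u + 1) -> False.
Proof.
move=> [n [Sn hn]] [n' [Sn' hn']].
have [le|lt] := leqP n n'.
  have [//||l hl e] := @path_crosses_down 0 n (u + 1); first by rewrite S0 Sn; lia.
  by apply: (hn' l) e; lia.
have [//||l hl e] := @path_crosses_up 0 n' (v - 1); first by rewrite S0 Sn'; lia.
by apply: (hn l) e; lia.
Qed.

Lemma exits_disjoint (b c : int) : b <> c ->
  reached_before S b c -> reached_before S c b -> False.
Proof.
move=> bc [n [Sn hn]] [n' [Sn' hn']].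
have [lt|gt|e] := ltngtP n n'; [exact: hn' Sn|exact: hn Sn'|].
by apply: bc; rewrite -Sn -Sn' e.
Qed.

(** Before the first visit to i the path stays strictly between u and v, where
    each vertex other than i has only one lift.  Hence the neighbours of i, when
    visited, are visited at v - 1 and at u + 1. *)
Lemma covered_last_not_before :
  covered_last m S i -> ~ reached_before S u (v - 1) /\
                        ~ reached_before S v (u + 1).
Proof.
move=> [n [[Sn first_n] others]].
have inside k : (k < n)%N -> u < S k < v.
  apply: path_inside => l /first_n hl; split=> e; apply: hl; apply/modz_short; lia.
have late l : S l = u \/ S l = v -> (n <= l)%N.
  by rewrite leqNgt => e; apply/negP => /inside; lia.
have seen j y : (j <= m)%N -> j <> i -> u < y < v ->
    y = j%:Z \/ y = j%:Z - m.+1%:Z -> exists2 k, (k < n)%N & S k = y.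
  move=> jm ji hy yj; have [k hk] := others j jm ji.
  have := inside k hk => ik /modz_short Sk; exists k => //.
  by case: Sk; lia.
split=> -[l [Sl hl]].
  have [||||k hk Sk] := seen i.-1 (v - 1); [lia|lia|lia|lia|].
  by have := late l; have := hl k; lia.
(* The vertex after i is i + 1, but it is labelled 0 when i = m. *)
have [im|im] := eqVneq i m.
  have [||||k hk Sk] := seen 0%N (u + 1); [lia|lia|lia|lia|].
  by have := late l; have := hl k; lia.
have [||||k hk Sk] := seen i.+1 (u + 1); [lia|lia|lia|lia|].
by have := late l; have := hl k; lia.
Qed.

(** Suppose that the path exits at v.  Unless it did so before visiting u + 1, it has
    travelled all the way from u + 1 to v, so all other vertices were visited.
    The exit at u is symmetric. *)
Lemma covered_last_total :
  reached_before S u v \/ reached_before S v u ->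
  [\/ covered_last m S i, reached_before S u (v - 1) |
      reached_before S v (u + 1)].
Proof.
move=> exits.
have {exits} [n [Sn hn]] : exists n, (S n = u \/ S n = v) /\
    forall k, (k < n)%N -> S k <> u /\ S k <> v.
  have ex : exists n, (S n == u) || (S n == v).
    by case: exits => -[n [e _]]; exists n; rewrite e eqxx ?orbT.
  case: (ex_minnP ex) => n hn min_n; exists n; split; first by lia.
  by move=> k hk; have := min_n k; lia.
have inside := @path_inside n hn.
have first_n k : (k < n)%N -> (S k %% m.+1%:Z)%Z <> i%:Z.
  by move=> /inside hk /modz_short; lia.
have Sni : (S n %% m.+1%:Z)%Z = i%:Z.
  by apply/modz_short; lia.
have all_seen : (forall y, u < y < v -> exists2 k, (k < n)%N & S k = y) ->
    covered_last m S i.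
  move=> seen; exists n; split=> // j jm ji.
  have [lt|ge] := ltnP j i.
    have [|k hk Sk] := seen j%:Z; first by lia.
    by exists k => //; apply/modz_short; lia.
  have [|k hk Sk] := seen (j%:Z - m.+1%:Z); first by lia.
  by exists k => //; apply/modz_short; lia.
case: Sn => Sn.
  have [h|h] := pselect (reached_before S u (v - 1)); first exact: Or32.
  apply: Or31; apply: all_seen => y hy.
  have [k hk Sk] : exists2 k, (k < n)%N & S k = v - 1.
    apply: contrapT => no; apply: h; exists n; split=> // k hk Sk.
    by apply: no; exists k.
  have [||l hl Sl] := @path_crosses_down k n y; [lia|rewrite Sn Sk; lia|].
  by exists l => //; lia.
have [h|h] := pselect (reached_before S v (u + 1)); first exact: Or33.
apply: Or31; apply: all_seen => y hy.
have [k hk Sk] : exists2 k, (k < n)%N & S k = u + 1.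
  apply: contrapT => no; apply: h; exists n; split=> // k hk Sk.
  by apply: no; exists k.
have [||l hl Sl] := @path_crosses_up k n y; [lia|rewrite Sn Sk; lia|].
by exists l => //; lia.
Qed.

End SimplePath.

(** * Means along a walk frozen at two points *)

Definition stopped_step (b c z e : int) : int :=
  if (z == b) || (z == c) then z else z + e.

Definition harmonic {R : realType} (p q : R) (h : int -> R) : Prop :=
  forall z, h z = p * h (z + 1) + q * h (z - 1).

(** The mean of [f] at the position after [n] steps of the walk started at [z]
    and frozen at [b] and [c]: the first step is averaged out at each stage. *)
Fixpoint stopped_mean {R : realType} (p q : R) (b c : int) (f : int -> R)
    (n : nat) (z : int) : R :=
  if n is n'.+1 then
    p * stopped_mean p q b c f n' (stopped_step b c z 1) +
    q * stopped_mean p q b c f n' (stopped_step b c z (-1))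
  else f z.

Section StoppedMean.
Context (R : realType) (p q : R).
Hypotheses (p_gt0 : 0 < p) (q_ge0 : 0 <= q) (pq1 : p + q = 1).

Lemma stopped_mean_sym b c f n z :
  stopped_mean p q b c f n z = stopped_mean p q c b f n z.
Proof.
by elim: n z => //= n IHn z; rewrite !IHn /stopped_step (orbC (z == b)).
Qed.

Lemma stopped_meanB b c f g n z :
  stopped_mean p q b c (fun x => f x - g x) n z =
  stopped_mean p q b c f n z - stopped_mean p q b c g n z.
Proof. by elim: n z => //= n IHn z; rewrite !IHn; ring. Qed.

Lemma stopped_mean_end b c f n z : (z == b) || (z == c) ->
  stopped_mean p q b c f n z = f z.
Proof.
by move=> hz; elim: n => //= n IHn; rewrite /stopped_step hz IHn -mulrDl pq1 mul1r.
Qed.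

Lemma stopped_mean_harmonic b c h n z : harmonic p q h ->
  stopped_mean p q b c h n z = h z.
Proof.
move=> hh; elim: n z => //= n IHn z; rewrite !IHn /stopped_step.
by case: ifP => _; [rewrite -mulrDl pq1 mul1r|rewrite [RHS]hh].
Qed.

(** The function V z = 1 + t ^ (v - u) - t ^ (z - u) with t = 2 / p lies between
    1 and C = 1 + t ^ (v - u) on the interval.  A step upwards alone contributes
    p t = 2 times t ^ (z - u) to the mean of t ^ (z - u), so one step lowers the
    mean of V by at least 1 at inner points, that is, multiplies it by at most
    1 - 1 / C.  Since g vanishes at the ends, a multiple of V dominates it there
    for ever, and the decay of V is inherited by the means of g. *)
Lemma stopped_mean_decay u v g : u <= v -> g u = 0 -> g v = 0 ->
  exists2 lam : R, 0 <= lam < 1 & exists K : R,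
    forall n z, u <= z <= v -> `|stopped_mean p q u v g n z| <= K * lam ^+ n.
Proof.
move=> uv gu gv.
move: (p_gt0) (q_ge0) (pq1) => p0 q0 pq.
have q1 : p <= 1 by lra.
have [t [t1 pt]] : exists t : R, 1 <= t /\ p * t = 2.
  exists (2 / p); split; first by rewrite ler_pdivlMr //; lra.
  by rewrite mulrC divfK // lt0r_neq0.
have t0 : 0 < t by lra.
pose V z : R := (1 + t ^ (v - u)) - t ^ (z - u).
pose C := 1 + t ^ (v - u).
have tz1 z : u <= z -> 1 <= t ^ (z - u).
  by move=> hz; rewrite -(expr0z t); apply: ler_weXz2l => //; lia.
have V1 z : u <= z <= v -> 1 <= V z.
  move=> /andP[uz zv]; rewrite /V -addrA lerDl subr_ge0.
  by apply: ler_weXz2l => //; lia.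
have VC z : V z <= C by rewrite /V /C gerBl exprz_ge0 // ltW.
have C1 : 1 < C by have := tz1 v uv; rewrite /C; lra.
have C0 : 0 < C by lra.
have CV0 : C^-1 * C = 1 by rewrite mulVf // lt0r_neq0.
have Ci0 : 0 < C^-1 by rewrite invr_gt0.
pose lam := 1 - C^-1.
have Vstep z : u < z < v -> p * V (z + 1) + q * V (z - 1) <= lam * V z.
  move=> /andP[uz zv].
  have e1 : t ^ (z + 1 - u) = t * t ^ (z - u).
    by rewrite addrAC expfzDr ?expr1z 1?mulrC // lt0r_neq0.
  have e2 := exprz_ge0 (z - 1 - u) (ltW t0).
  have := VC z; have := tz1 z (ltW uz) => h1 h2.
  have h3 : C^-1 * V z <= 1 by rewrite -CV0 ler_pM2l.
  have h4 : 0 <= q * t ^ (z - 1 - u) by rewrite mulr_ge0.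
  have -> : lam * V z = V z - C^-1 * V z by rewrite /lam; ring.
  have -> : p * V (z + 1) + q * V (z - 1) =
      (p + q) * C - p * t * t ^ (z - u) - q * t ^ (z - 1 - u).
    by rewrite /V e1 /C; ring.
  have VE : V z = C - t ^ (z - u) by [].
  by rewrite pq1 pt; move: (V z) VE h2 h3 => x VE h2 h3; lra.
have lam01 : 0 <= lam < 1.
  rewrite /lam; apply/andP; split; last by lra.
  by rewrite subr_ge0 invf_le1; lra.
(* K serves as a bound of |g| on the finitely many points of the interval. *)
pose K := \sum_(k < `|v - u|%N.+1) `|g (u + k%:Z)|.
have K0 : 0 <= K by apply: sumr_ge0.
have gK z : u <= z <= v -> `|g z| <= K.
  move=> hz; have hk : (`|z - u|%N < `|v - u|%N.+1)%N by lia.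
  rewrite /K (bigD1 (Ordinal hk)) //=.
  have -> : u + `|z - u|%N%:Z = z by lia.
  by rewrite lerDl sumr_ge0.
have bound n z : u <= z <= v ->
    `|stopped_mean p q u v g n z| <= K * V z * lam ^+ n.
  elim: n z => [|n IHn] z hz.
    rewrite expr0 mulr1 /=; apply: le_trans (gK z hz) _.
    by rewrite ler_peMr // V1.
  have [hend|hend] := boolP ((z == u) || (z == v)).
    rewrite stopped_mean_end //.
    have -> : g z = 0 by case/orP: hend => /eqP->.
    rewrite normr0 mulr_ge0 ?exprn_ge0 ?mulr_ge0 //; last by lra.
    by apply: le_trans (V1 z hz).
  rewrite /= /stopped_step (negbTE hend).
  have i1 : u <= z + 1 <= v by lia.
  have i2 : u <= z - 1 <= v by lia.
  apply: le_trans (ler_normD _ _) _.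
  rewrite !normrM (gtr0_norm p_gt0) (ger0_norm q_ge0).
  have h1 := ler_wpM2l (ltW p_gt0) (IHn _ i1).
  have h2 := ler_wpM2l q_ge0 (IHn _ i2).
  apply: le_trans (lerD h1 h2) _.
  have -> : p * (K * V (z + 1) * lam ^+ n) + q * (K * V (z - 1) * lam ^+ n) =
      K * lam ^+ n * (p * V (z + 1) + q * V (z - 1)) by ring.
  rewrite exprS.
  have -> : K * V z * (lam * lam ^+ n) = K * lam ^+ n * (lam * V z) by ring.
  apply: ler_wpM2l; last by apply: Vstep; lia.
  by rewrite mulr_ge0 // exprn_ge0 //; lra.
exists lam => //; exists (K * C) => n z hz.
apply: le_trans (bound n z hz) _.
by rewrite ler_wpM2r ?exprn_ge0 ?ler_wpM2l //; lra.
Qed.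

(** The difference f - h vanishes at both ends, so its means decay, while those
    of h do not change.  For h = 1 and f the indicator of the two ends, this is
    almost sure absorption. *)
Lemma cvg_stopped_mean (b c z : int) (f h : int -> R) :
  harmonic p q h -> f b = h b -> f c = h c ->
  (b <= z <= c) || (c <= z <= b) ->
  stopped_mean p q b c f n z @[n --> \oo] --> h z.
Proof.
move=> hh fb fc hz.
wlog bzc : b c fb fc hz / b <= z <= c.
  move=> W; case/orP: (hz) => hz'; first exact: W.
  under eq_fun do rewrite stopped_mean_sym.
  by apply: W => //; rewrite orbC.
have [|||lam lam01 [K hK]] := @stopped_mean_decay b c (fun x => f x - h x).
- lia.
- by rewrite fb subrr.
- by rewrite fc subrr.
have c0 : K * lam ^+ n @[n --> \oo] --> (0 : R).
  rewrite -(mulr0 K); apply: cvgM; first exact: cvg_cst.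
  by apply: cvg_expr; rewrite ger0_norm; lra.
apply: (@cvg_zero _ R^o); apply: norm_cvg0.
apply: (squeeze_cvgr _ (cvg_cst (0 : R)) c0); near=> n.
rewrite normr_ge0 /=; apply: le_trans (hK n z bzc).
by rewrite stopped_meanB (stopped_mean_harmonic b c h).
Unshelve. all: by end_near. Qed.

End StoppedMean.

(** * The frozen walk and the event of reaching a point first *)

Definition walk (x : nat -> int) (n : nat) : int := \sum_(k < n) x k.

Fixpoint stopped_walk (b c : int) (x : nat -> int) (n : nat) : int :=
  if n is n'.+1 then stopped_step b c (stopped_walk b c x n') (x n') else 0.

Lemma walkS x n : walk x n.+1 = walk x n + x n.
Proof. exact: big_ord_recr. Qed.

Section StoppedWalk.
Context (b c : int) (x : nat -> int).
Hypothesis bc : b <> c.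

Lemma eq_stopped_walk y n : (forall k, (k < n)%N -> x k = y k) ->
  stopped_walk b c x n = stopped_walk b c y n.
Proof.
elim: n => //= n IHn xy; rewrite IHn ?xy // => k hk.
by apply: xy; apply: ltnW.
Qed.

Lemma stopped_walk_absorbed n n' (e : int) : (e == b) || (e == c) ->
  (n <= n')%N -> stopped_walk b c x n = e -> stopped_walk b c x n' = e.
Proof.
move=> he; elim: n' => [|n' IH]; first by rewrite leqn0 => /eqP->.
rewrite leq_eqVlt => /orP[/eqP->//|hn] hx.
by rewrite /= (IH hn hx) /stopped_step he.
Qed.

Lemma stopped_walk_free n :
  (forall k, (k < n)%N -> stopped_walk b c x k <> b /\
                          stopped_walk b c x k <> c) ->
  forall k, (k <= n)%N -> stopped_walk b c x k = walk x k.
Proof.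
move=> free; elim=> [_|k IH hk]; first by rewrite /walk big_ord0.
have [/eqP/negbTE kb /eqP/negbTE kc] := free k hk.
by rewrite walkS /= /stopped_step kb kc IH // ltnW.
Qed.

Lemma walk_free n :
  (forall k, (k < n)%N -> walk x k <> b /\ walk x k <> c) ->
  stopped_walk b c x n = walk x n.
Proof.
elim: n => [_|n IH free]; first by rewrite /walk big_ord0.
have e : stopped_walk b c x n = walk x n.
  by apply: IH => k hk; apply: free; apply: ltnW.
have [/eqP/negbTE kb /eqP/negbTE kc] := free n (ltnSn n).
by rewrite walkS /= /stopped_step e kb kc.
Qed.

(** Frozen at b or c, the walk records at a single late time which of the two
    points was hit first; this turns an event about whole paths into an
    increasing union of events about one position. *)
Lemma reached_before_stopped :
  reached_before (walk x) b c <-> exists n, stopped_walk b c x n = b.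
Proof.
split=> [[n [xn hn]]|ex].
  have ex : exists n, walk x n == b by exists n; rewrite xn.
  case: (ex_minnP ex) => k /eqP xk min_k; exists k.
  rewrite walk_free // => l lk; split; first by move/eqP/min_k; lia.
  by apply: hn; have := min_k n; rewrite xn eqxx => /(_ isT); lia.
have {}ex : exists n, stopped_walk b c x n == b by case: ex => n e; exists n; apply/eqP.
case: (ex_minnP ex) => n /eqP xn min_n.
have free k : (k < n)%N -> stopped_walk b c x k <> b /\
    stopped_walk b c x k <> c.
  move=> hk; split=> e; first by have := min_n k; rewrite e eqxx; lia.
  apply: bc; rewrite -xn; apply: stopped_walk_absorbed (ltnW hk) e.
  by rewrite eqxx orbT.
have agree := stopped_walk_free n free.
exists n; split; first by rewrite -agree.
by move=> k hk; rewrite -agree ?(ltnW hk) //; case: (free k hk).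
Qed.

End StoppedWalk.

(** * The law of the frozen walk *)

Section WalkLaw.
Context {R : realType} {d : measure_display} {T : measurableType d}.
Context {P : probability T R} (X : nat -> {RV P >-> int}).

Definition path_of (w : T) : nat -> int := fun k => X k w.

Definition cylinder (s : seq int) : set T :=
  [set w | forall j, (j < size s)%N -> X j w = nth 0 s j].

Lemma measurable_step k (A : set int) : measurable (X k @^-1` A).
Proof. by apply: measurable_funPTI. Qed.

Lemma cylinderE s :
  cylinder s = \bigcap_(j in [set` iota 0 (size s)]) (X j @^-1` [set nth 0 s j]).
Proof.
apply/seteqP; split=> w /= hw j; last by move=> js; apply: hw; rewrite /= mem_iota.
by rewrite /= mem_iota => /andP[_ js]; apply: hw.
Qed.

Lemma measurable_cylinder s : measurable (cylinder s).
Proof.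
rewrite cylinderE; apply: bigcap_measurableType => // j _.
exact: measurable_step.
Qed.

(** Only countably many finite sequences of integers are possible as the first
    [n] steps, so an event depending on these alone is a countable union of
    cylinders. *)
Lemma measurable_prefix n (A : set T) :
  (forall w w', (forall j, (j < n)%N -> X j w = X j w') -> A w -> A w') ->
  measurable A.
Proof.
move=> det.
have -> : A = \bigcup_(s : seq int)
    (if `[<exists2 w, A w & size s = n /\ cylinder s w>] then cylinder s
     else set0).
  apply/seteqP; split=> w.
    move=> Aw; exists [seq X j w | j <- iota 0 n] => //.
    have h : cylinder [seq X j w | j <- iota 0 n] w.
      move=> j; rewrite size_map size_iota => jn.
      by rewrite (nth_map 0%N) ?size_iota // nth_iota.
    by rewrite asboolT //; exists w => //; split=> //; rewrite size_map size_iota.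
  move=> [s _]; case: asboolP => // -[w' Aw' [sn sw']] sw.
  by apply: det Aw' => j jn; rewrite sw' ?sw // sn.
apply: countable_bigcupT_measurable => [|s]; first exact: countableP.
by case: ifP => _; [exact: measurable_cylinder|exact: measurable0].
Qed.

Context {p q : R}.
Hypothesis X_indep : mutually_independent X.
Hypothesis X_cw : forall k, P (X k @^-1` [set 1]) = p%:E.
Hypothesis X_ccw : forall k, P (X k @^-1` [set -1]) = q%:E.
Hypothesis pq1 : p + q = 1.

Definition step_weight (e : int) : R := if e == 1 then p else q.

Lemma prob_cylinder s : {in s, forall e, e = 1 \/ e = -1} ->
  P (cylinder s) = (\prod_(e <- s) step_weight e)%:E.
Proof.
move=> hs; rewrite cylinderE X_indep ?iota_uniq //.
rewrite [in RHS](big_nth 0) -prodEFin /index_iota subn0.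
rewrite big_seq [RHS]big_seq; apply: eq_bigr => j; rewrite mem_iota /= => js.
rewrite /step_weight; case: eqP => [->|ne]; first exact: X_cw.
by have [//|->] := hs _ (mem_nth 0 js); apply: X_ccw.
Qed.

Lemma prob_one_setI (A G : set T) : measurable A -> measurable G ->
  P G = 1%E -> P (A `&` G) = P A.
Proof.
move=> mA mG G1; rewrite [RHS](measureDI P mA mG).
rewrite -[LHS]add0e; congr (_ + _)%E; apply/esym.
apply: (@subset_measure0 _ _ _ _ _ (~` G)).
- exact: measurableD.
- exact: measurableC.
- by move=> w [].
- by rewrite [LHS](probability_setC P mG) G1 subee.
Qed.

Definition unit_step k : set T := X k @^-1` [set 1] `|` X k @^-1` [set -1].

(** The step laws are only prescribed at 1 and -1, but p + q = 1 leaves no mass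
    elsewhere. *)
Lemma prob_unit_step k : P (unit_step k) = 1%E.
Proof.
have : P (unit_step k) = (P (X k @^-1` [set 1%R]) + P (X k @^-1` [set (-1)%R]))%E.
  apply: measureU; try exact: measurable_step.
  by apply/seteqP; split=> w //= [-> ].
by rewrite X_cw X_ccw -EFinD pq1.
Qed.

Lemma prob_unit_steps : P (\bigcap_k unit_step k) = 1%E.
Proof.
have mU k : measurable (unit_step k).
  by apply: measurableU; apply: measurable_step.
have mG : measurable (\bigcap_k unit_step k) by apply: bigcapT_measurable.
have G0 : P (~` \bigcap_k unit_step k) = 0%E.
  apply/negligibleP; first exact: measurableC.
  rewrite setC_bigcap; apply: negligible_bigcup => k.
  apply/negligibleP; first exact: measurableC.
  by rewrite [LHS](probability_setC P (mU k)) prob_unit_step subee.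
have := probability_setC P (measurableC mG).
by rewrite setCK G0 sube0.
Qed.

Lemma cylinder_rcons s e :
  cylinder (rcons s e) = cylinder s `&` (X (size s) @^-1` [set e]).
Proof.
apply/seteqP; split=> w.
  move=> h; split=> [j js|/=].
    by rewrite h ?size_rcons ?nth_rcons ?js // ltnW.
  by rewrite h ?size_rcons // nth_rcons ltnn eqxx.
move=> [h /= he] j; rewrite size_rcons ltnS leq_eqVlt nth_rcons.
by case: ltngtP => //= [js _|-> _]; [apply: h|].
Qed.

Lemma stopped_walk_cylinder b c s w : cylinder s w ->
  stopped_walk b c (path_of w) (size s) = foldl (stopped_step b c) 0 s.
Proof.
elim/last_ind: s => //= s e IH; rewrite cylinder_rcons => -[ws we].
by rewrite size_rcons foldl_rcons /= IH // /path_of we.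
Qed.

Lemma measurable_stopped_walk b c n (A : set int) :
  measurable [set w | A (stopped_walk b c (path_of w) n)].
Proof.
apply: (@measurable_prefix n) => w w' ww' /=.
by rewrite (@eq_stopped_walk b c (path_of w) (path_of w')).
Qed.

(** Conditioning on an arbitrary initial word [s] is what makes the induction
    on [n] work: the next step extends the word, and the recursion for
    [stopped_mean] matches the splitting of the cylinder according to it. *)
Lemma prob_cylinder_stopped_walk b c (Q : pred int) n s :
  {in s, forall e, e = 1 \/ e = -1} ->
  P (cylinder s `&` [set w | Q (stopped_walk b c (path_of w) (size s + n))]) =
  (\prod_(e <- s) step_weight e *
   stopped_mean p q b c (fun z => (Q z)%:R) n (foldl (stopped_step b c) 0 s))%:E.
Proof.
elim: n s => [|n IHn] s hs.
  rewrite /= addn0; case: (boolP (Q _)) => hQ.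
    rewrite mulr1 -prob_cylinder //; congr (P _); apply/seteqP.
    by split=> w; [case|split=> //=; rewrite stopped_walk_cylinder].
  rewrite mulr0 (_ : _ `&` _ = set0) ?measure0 //.
  apply/seteqP; split=> w //= -[ws]; rewrite stopped_walk_cylinder //.
  by rewrite (negbTE hQ).
set B := [set w | _].
have mB : measurable B by exact: (measurable_stopped_walk b c _ [set z | Q z]).
have mD := measurableI _ _ (measurable_cylinder s) mB.
rewrite -(@prob_one_setI _ (unit_step (size s))) ?prob_unit_step //; last first.
  by apply: measurableU; apply: measurable_step.
have -> : P (cylinder s `&` B `&` unit_step (size s)) =
    (P (cylinder s `&` B `&` X (size s) @^-1` [set 1%R]) +
     P (cylinder s `&` B `&` X (size s) @^-1` [set (-1)%R]))%E.
  rewrite setIUr; apply: measureU.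
  - exact: measurableI mD (measurable_step _ _).
  - exact: measurableI mD (measurable_step _ _).
  - by apply/seteqP; split=> w //= [[_ ->] []].
have split e : e = 1 \/ e = -1 ->
    P ((cylinder s `&` B) `&` X (size s) @^-1` [set e]) =
    (\prod_(e <- s) step_weight e * step_weight e *
     stopped_mean p q b c (fun z => (Q z)%:R) n
       (stopped_step b c (foldl (stopped_step b c) 0 s) e))%:E.
  move=> he; rewrite setIAC -cylinder_rcons.
  have := IHn (rcons s e); rewrite size_rcons addSnnS => -> //.
    by rewrite -cats1 big_cat big_seq1 foldl_cat.
  by move=> e'; rewrite mem_rcons inE => /orP[/eqP->|/hs].
rewrite !split; [|by right|by left].
rewrite -EFinD /step_weight eqxx /=; congr (_%:E); ring.
Qed.

Lemma prob_stopped_walk b c (Q : pred int) n :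
  P [set w | Q (stopped_walk b c (path_of w) n)] =
  (stopped_mean p q b c (fun z => (Q z)%:R) n 0)%:E.
Proof.
have := @prob_cylinder_stopped_walk b c Q n [::]; rewrite big_nil mul1r /= => <- //.
by congr (P _); apply/seteqP; split=> w; [|case].
Qed.

End WalkLaw.

(** * Gambler's ruin, and the last vertex as its complement *)

Section ReachProbability.
Context (R : realType) (d : measure_display) (T : measurableType d).
Context (P : probability T R) (X : nat -> {RV P >-> int}) (p q : R).
Hypotheses (p_gt0 : 0 < p) (q_ge0 : 0 <= q) (pq1 : p + q = 1).
Hypothesis X_indep : mutually_independent X.
Hypothesis X_cw : forall k, P (X k @^-1` [set 1]) = p%:E.
Hypothesis X_ccw : forall k, P (X k @^-1` [set -1]) = q%:E.

Let reach b c : set T := [set w | reached_before (walk (path_of X w)) b c].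

Lemma reachE b c : b <> c ->
  reach b c = \bigcup_n [set w | stopped_walk b c (path_of X w) n == b].
Proof.
move=> bc; apply/seteqP; split=> w.
  by move=> /reached_before_stopped[//|n e]; exists n => //=; apply/eqP.
move=> [n _ /= /eqP e].
by apply/reached_before_stopped => //; exists n.
Qed.

Lemma measurable_reach b c : b <> c -> measurable (reach b c).
Proof.
move=> bc; rewrite reachE //; apply: bigcupT_measurable => n.
exact: (measurable_stopped_walk X b c n [set z | z == b]).
Qed.

Lemma prob_reach_harmonic b c h : b <> c -> harmonic p q h ->
  h b = 1 -> h c = 0 -> (b <= 0 <= c) || (c <= 0 <= b) ->
  P (reach b c) = (h 0)%:E.
Proof.
move=> bc hh hb hc z0.
have cvgP : P [set w | stopped_walk b c (path_of X w) n == b] @[n --> \oo]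
    --> P (reach b c).
  rewrite reachE //; apply: nondecreasing_cvg_mu.
  - move=> n.
    exact: (measurable_stopped_walk X b c n [set z | z == b]).
  - rewrite -reachE //; exact: measurable_reach.
  - move=> n n' nn'; apply/subsetPset => w /= /eqP e; apply/eqP.
    by apply: stopped_walk_absorbed nn' e; rewrite eqxx.
apply: (cvg_unique _ cvgP) => //.
have -> : (fun n => P [set w | stopped_walk b c (path_of X w) n == b]) =
    EFin \o (fun n => stopped_mean p q b c (fun z => (z == b)%:R) n 0).
  by apply/funext => n; apply: (prob_stopped_walk X X_indep X_cw X_ccw pq1 b c).
apply: cvg_EFin; first exact: nearW.
apply: cvg_stopped_mean => //=; first by rewrite eqxx hb.
by rewrite hc; case: eqP => // e; case: bc.
Qed.

(** Here psi is normalised to the affine image which is 1 at b and 0 at c. *)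
Lemma prob_reach b c psi : harmonic p q psi -> psi b != psi c ->
  (b <= 0 <= c) || (c <= 0 <= b) ->
  P (reach b c) = ((psi c - psi 0) / (psi c - psi b))%:E.
Proof.
move=> hpsi bc z0; have n0 : psi c - psi b != 0 by rewrite subr_eq0 eq_sym.
rewrite (prob_reach_harmonic _ _ (fun z => (psi c - psi z) / (psi c - psi b))) //.
- by move=> e; rewrite e eqxx in bc.
- move=> z; rewrite [in LHS](hpsi z) -{1}[psi c]mul1r -pq1; field.
  by rewrite n0.
- by rewrite divff.
- by rewrite subrr mul0r.
Qed.

Lemma measurable_last_visited m i : measurable (last_visited m X i).
Proof.
have -> : last_visited m X i = \bigcup_n [set w | first_visit m X i n w /\
    forall j, (j <= m)%N -> j <> i ->
      exists2 k, (k < n)%N & position m X k w = j%:Z].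
  by apply/seteqP; split=> w [n]; exists n.
apply: bigcupT_measurable => n.
apply: (measurable_prefix X n) => w w' ww' /=.
have e k : (k <= n)%N -> position m X k w = position m X k w'.
  move=> kn; congr (_ %% _)%Z; apply: eq_bigr => j _.
  by apply: ww'; apply: leq_trans kn.
move=> [[en hn] seen]; split; first split.
- by rewrite -e.
- by move=> k kn; rewrite -e; [exact: hn|exact: ltnW].
- move=> j jm ji; have [k kn ek] := seen j jm ji; exists k => //.
  by rewrite -e // ltnW.
Qed.

(** Off a null set, exactly one of three things happens: i comes last, u is
    reached before v - 1, or v is reached before u + 1. *)
Lemma prob_last_visited m i psi : harmonic p q psi -> injective psi ->
  (1 <= i <= m)%N ->
  let u := i%:Z - m.+1%:Z in let v := i%:Z in
  P (last_visited m X i) =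
    (1 - (psi (v - 1) - psi 0) / (psi (v - 1) - psi u)
       - (psi (u + 1) - psi 0) / (psi (u + 1) - psi v))%:E.
Proof.
move=> hpsi inj_psi hi u v.
have prob b c : b <> c -> (b <= 0 <= c) || (c <= 0 <= b) ->
    P (reach b c) = ((psi c - psi 0) / (psi c - psi b))%:E.
  by move=> bc; apply: prob_reach => //; apply/eqP => /inj_psi.
have uv : u <> v by lia.
have vu : v <> u by lia.
have uv1 : u <> v - 1 by lia.
have vu1 : v <> u + 1 by lia.
pose G := (reach u v `|` reach v u) `&` \bigcap_k unit_step X k.
have mU k : measurable (unit_step X k).
  by apply: measurableU; apply: measurable_step.
have mE : measurable (reach u v `|` reach v u).
  by apply: measurableU; apply: measurable_reach.
have mG : measurable G by apply: measurableI => //; apply: bigcapT_measurable.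
have PE : P (reach u v `|` reach v u) = 1%E.
  have -> : P (reach u v `|` reach v u) = (P (reach u v) + P (reach v u))%E.
    apply: measureU; [exact: measurable_reach|exact: measurable_reach|].
    by apply/seteqP; split=> w //= -[h1 h2]; apply: exits_disjoint h1 h2.
  rewrite !prob //; try lia.
  rewrite -EFinD; congr (_%:E).
  have : psi u - psi v != 0 by rewrite subr_eq0; apply/eqP => /inj_psi.
  have : psi v - psi u != 0 by rewrite subr_eq0; apply/eqP => /inj_psi.
  by move=> h1 h2; field; rewrite h1 h2.
have PG : P G = 1%E.
  rewrite prob_one_setI ?PE //; first exact: bigcapT_measurable.
  exact: (prob_unit_steps X X_cw X_ccw pq1).
pose L := last_visited m X i.
have mL : measurable L by apply: measurable_last_visited.
pose A := reach u (v - 1); pose B := reach v (u + 1).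
have mA : measurable A by apply: measurable_reach.
have mB : measurable B by apply: measurable_reach.
have G_step w : G w -> forall n,
    walk (path_of X w) n.+1 = walk (path_of X w) n + 1 \/
    walk (path_of X w) n.+1 = walk (path_of X w) n - 1.
  by move=> [_ steps] n; rewrite walkS; case: (steps n I) => /= <-; [left|right].
have W0 w : walk (path_of X w) 0 = 0 by exact: big_ord0.
have split : P G = (P (L `&` G) + (P (A `&` G) + P (B `&` G)))%E.
  have <- : P (A `&` G `|` B `&` G) = (P (A `&` G) + P (B `&` G))%E.
    apply: measureU; [exact: measurableI|exact: measurableI|].
    apply/seteqP; split=> w //= -[[Aw Gw] [Bw _]].
    exact: (reached_before_neighbours_disjoint _ (G_step w Gw) m i) Aw Bw.
  have <- : P (L `&` G `|` (A `&` G `|` B `&` G)) =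
      (P (L `&` G) + P (A `&` G `|` B `&` G))%E.
    apply: measureU; [exact: measurableI| |].
      by apply: measurableU; apply: measurableI.
    apply/seteqP; split=> w //= -[[Lw Gw] AB].
    have [nA nB] := covered_last_not_before _ (G_step w Gw) m i (W0 w) hi Lw.
    by case: AB => -[].
  congr (P _); apply/seteqP; split=> w; last by case=> [[]|[[]|[]]].
  move=> Gw; have [exits _] := Gw.
  have [] := covered_last_total _ (G_step w Gw) m i (W0 w) hi exits.
  - by left.
  - by right; left.
  - by right; right.
move: split; rewrite PG (prob_one_setI L G) // (prob_one_setI A G) //.
rewrite (prob_one_setI B G) //.
rewrite !prob //; try lia.
rewrite -(fineK (fin_num_measure P L mL)) -!EFinD => -[] e; congr (_%:E).
by rewrite [X in X - _ - _]e; ring.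
Qed.

End ReachProbability.

(** * The explicit harmonic function *)

Definition harmonic_scale {R : realType} (r : R) (z : int) : R :=
  if r == 1 then z%:~R else r ^ z.

Lemma harmonic_scale_harmonic (R : realType) (p q r : R) :
  0 < p -> 0 < q -> p + q = 1 -> r = q / p -> harmonic p q (harmonic_scale r).
Proof.
move=> p0 q0 pq hr z; rewrite /harmonic_scale.
have qE : q = r * p by rewrite hr divfK // lt0r_neq0.
have r0 : r != 0 by rewrite hr mulf_neq0 ?invr_eq0 ?lt0r_neq0.
case: eqP => [r1|_].
  have -> : p = 1 - q by lra.
  have -> : q = 1 / 2 by rewrite r1 in qE; lra.
  by rewrite !intrD; field.
have -> : z + 1 = z - 1 + 1 + 1 by lia.
have {1}-> : z = z - 1 + 1 by lia.
rewrite !expfzDr // !expr1z.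
have rE : r = r * (p + r * p) by rewrite -qE pq mulr1.
by rewrite [X in _ * X = _]rE qE; ring.
Qed.

Lemma harmonic_scale_inj (R : realType) (r : R) :
  0 < r -> injective (harmonic_scale r).
Proof.
move=> r0 y z; rewrite /harmonic_scale; case: eqP => [_|/eqP r1].
  exact: intr_inj.
exact: ieexprIz.
Qed.

Theorem theorem3p2 (R : realType) (d : measure_display) (T : measurableType d)
    (P : probability T R) (m : nat) (p q r : R) (X : nat -> {RV P >-> int})
    (hm : (2 <= m)%N) (hp : 0 < p < 1) (hq : q = 1 - p) (hr : r = q / p)
    (X_indep : mutually_independent X)
    (X_cw : forall k, P (X k @^-1` [set 1]) = p%:E)
    (X_ccw : forall k, P (X k @^-1` [set -1]) = q%:E)
    (i : nat) (hi : (1 <= i <= m)%N) :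
  P (last_visited m X i) =
    (if r == 1 then 1 / m%:R else r ^+ (m - i) * (r - 1) / (r ^+ m - 1))%:E.
Proof.
have p0 : 0 < p by lra.
have q0 : 0 < q by lra.
have pq : p + q = 1 by lra.
have r0 : 0 < r by rewrite hr divr_gt0.
rewrite (@prob_last_visited R d T P X p q p0 (ltW q0) pq X_indep X_cw X_ccw
  m i (harmonic_scale r)) //; last 2 first.
- exact: harmonic_scale_harmonic.
- exact: harmonic_scale_inj.
congr (_%:E); have := @harmonic_scale_inj R r r0.
(* With a = i - 1 and b = m - i all exponents below are sums of a, b and 1. *)
have [a [b [ia mb]]] : exists a b, i = a.+1 /\ m = (a + b.+1)%N.
  by exists i.-1, (m - i)%N; lia.
have mi : (m - i)%N = b by lia.
have -> : i%:Z - 1 = a by lia.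
have -> : i%:Z - m.+1%:Z + 1 = - b%:Z by lia.
have -> : i%:Z - m.+1%:Z = - b.+1%:Z by lia.
rewrite /harmonic_scale mi ia mb; case: eqP => [_|/eqP r1] inj.
  have n0 : a%:R + b%:R + 1 != 0 :> R.
    by rewrite -natrD natr1 pnatr_eq0.
  rewrite !intrN -!pmulrn natrD -!natr1 mulr0n.
  by field; rewrite -opprB opprK addrC ?oppr_eq0; lra.
rewrite expr0z -!exprnN -!exprnP exprD !exprS.
have n0 : r ^+ a * (r * r ^+ b) - 1 != 0.
  rewrite subr_eq0 -exprS -exprD -(expr0z r); apply/eqP => e.
  by have := inj (a + b.+1)%:Z 0 e; lia.
have A0 := expf_neq0 a (lt0r_neq0 r0); have B0 := expf_neq0 b (lt0r_neq0 r0).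
move: (r ^+ a) (r ^+ b) A0 B0 n0 => A B A0 B0 n0.
field; rewrite n0 B0 (lt0r_neq0 r0) andbT /= -oppr_eq0.
by rewrite (_ : - _ = A * (r * B) - 1) //; ring.
Qed.
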